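(* For every prime power $q$ there exist constants $c,C>0$ (depending only on $q$) and an infinite sequence $(Q_t^{(1)},Q_t^{(2)},Q_t^{(3)})_{t\in\mathbb{N}}$ of triples of quantum CSS codes over $\mathbb{F}_q$, each triple supporting a transversal $CCZ_q$ gate, such that the codes of the $t$-th triple have parameters $[[n_t,k_t,d_t]]_q$ with $n_t\to\infty$ as $t\to\infty$ and $$k_t\geq c\,\frac{n_t}{2^{C\log^* n_t}},\qquad d_t\geq c\,\frac{n_t}{2^{C\log^* n_t}}.$$ Furthermore, if $q\geq 5$ one can ensure $Q_t^{(1)}=Q_t^{(2)}=Q_t^{(3)}$ for every $t$, so that these codes also support a transversal $U_q$ gate.
   Context: $\log^*n$ is the number of times the logarithm must be iteratively applied starting from $n$ to obtain a value $\leq 1$. A quantum CSS code $\mathrm{CSS}(Q_X,Q_Z)$ of length $n$ over $\mathbb{F}_q$ is a pair of subspaces $Q_X,Q_Z\subseteq\mathbb{F}_q^n$ with $Q_X^\perp\subseteq Q_Z$ (duals w.r.t. $x\cdot y=\sum_ix_iy_i$), of dimension $k=\dim Q_Z-\dim Q_X^\perp$ and distance $d=\min\{|y|:y\in(Q_X\setminus Q_Z^\perp)\cup(Q_Z\setminus Q_X^\perp)\}$ (Hamming weight). A $Z$ encoding function is an $\mathbb{F}_q$-linear isomorphism $\mathrm{Enc}_Z:\mathbb{F}_q^k\to Q_Z/Q_X^\perp$. A triple $(Q^{(h)};\mathrm{Enc}^{(h)}_Z)_{h\in[3]}$ of $[[n,k]]_q$ codes supports a transversal $CCZ_q$ gate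 if there is $b\in\mathbb{F}_q^n$ such that for all $z^{(h)}\in\mathbb{F}_q^k$ and all $z^{(h)\prime}\in\mathrm{Enc}^{(h)}_Z(z^{(h)})$, $\sum_{j\in[k]}z^{(1)}_jz^{(2)}_jz^{(3)}_j=\sum_{j\in[n]}b_jz^{(1)\prime}_jz^{(2)\prime}_jz^{(3)\prime}_j$. A code supports a transversal $U_q$ gate if there is $b\in\mathbb{F}_q^n$ with $\sum_{j\in[k]}z_j^3=\sum_{j\in[n]}b_jz_j'^3$ for all $z\in\mathbb{F}_q^k$, $z'\in\mathrm{Enc}_Z(z)$. *)

(* Defs.v *)
From HB Require Import structures.
From mathcomp Require Import all_boot all_order all_algebra.
From mathcomp Require Import all_classical all_reals exp.
Set Implicit Arguments. Unset Strict Implicit. Unset Printing Implicit Defensive.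
Import Order.TTheory GRing.Theory Num.Theory.
Local Open Scope ring_scope.

Section Codes.
Variable F : finFieldType.

Definition dotv n (x y : 'rV[F]_n) : F := \sum_(i < n) x 0 i * y 0 i.

Definition dualv n (U : {vspace 'rV[F]_n}) : {vspace 'rV[F]_n} :=
  <<[seq x <- enum 'rV[F]_n | [forall y : 'rV[F]_n, (y \in U) ==> (dotv x y == 0%R)]]>>%VS.

Definition wt n (x : 'rV[F]_n) : nat := #|[set i : 'I_n | x 0 i != 0]|.

Record css_pair (n : nat) := CSS { QX : {vspace 'rV[F]_n}; QZ : {vspace 'rV[F]_n} }.

Definition is_css n (Q : css_pair n) : Prop := (dualv (QX Q) <= QZ Q)%VS.

Definition css_dim n (Q : css_pair n) : nat := (\dim (QZ Q) - \dim (dualv (QX Q)))%N.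

Definition css_logical n (Q : css_pair n) (y : 'rV[F]_n) : bool :=
  ((y \in QX Q) && (y \notin dualv (QZ Q))) || ((y \in QZ Q) && (y \notin dualv (QX Q))).

(* distance = minimum weight of a nontrivial logical operator
   (the default value n is only used when that set is empty, i.e. k = 0) *)
Definition css_dist n (Q : css_pair n) : nat :=
  \big[minn/n]_(y : 'rV[F]_n | css_logical Q y) wt y.

(* A Z encoding function Enc_Z : F^k -> Q_Z / Q_X^perp, an F-linear isomorphism,
   represented by a linear lift z |-> z *m E with values in Q_Z:
   the coset Enc_Z(z) is  z *m E + Q_X^perp. *)
Definition is_encZ n k (Q : css_pair n) (E : 'M[F]_(k, n)) : Prop :=
  [/\ forall z : 'rV[F]_k, z *m E \in QZ Q,
      forall z : 'rV[F]_k, z *m E \in dualv (QX Q) -> z = 0 &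
      forall w : 'rV[F]_n, w \in QZ Q -> exists z : 'rV[F]_k, w - z *m E \in dualv (QX Q)].

Definition in_enc n k (Q : css_pair n) (E : 'M[F]_(k, n)) (z : 'rV[F]_k) (z' : 'rV[F]_n) :=
  z' - z *m E \in dualv (QX Q).

Definition supports_CCZ n k (Q : 'I_3 -> css_pair n) (E : 'I_3 -> 'M[F]_(k, n)) : Prop :=
  exists b : 'rV[F]_n,
    forall (z1 z2 z3 : 'rV[F]_k) (z1' z2' z3' : 'rV[F]_n),
      in_enc (Q 0) (E 0) z1 z1' -> in_enc (Q 1) (E 1) z2 z2' -> in_enc (Q 2) (E 2) z3 z3' ->
      \sum_(j < k) z1 0 j * z2 0 j * z3 0 j = \sum_(j < n) b 0 j * z1' 0 j * z2' 0 j * z3' 0 j.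

Definition supports_U n k (Q : css_pair n) (E : 'M[F]_(k, n)) : Prop :=
  exists b : 'rV[F]_n,
    forall (z : 'rV[F]_k) (z' : 'rV[F]_n), in_enc Q E z z' ->
      \sum_(j < k) z 0 j ^+ 3 = \sum_(j < n) b 0 j * z' 0 j ^+ 3.

End Codes.

Section LogStar.
Variable R : realType.

Definition log2 (x : R) : R := ln x / ln 2.

Fixpoint logstar_fuel (fuel : nat) (x : R) : nat :=
  match fuel with
  | O => O
  | S f => if x <= 1 then O else (logstar_fuel f (log2 x)).+1
  end.

(* log^* n; fuel n suffices (each step from x >= 2 decreases by >= 1) *)
Definition logstar (n : nat) : nat := logstar_fuel n n%:R.

Definition rate_bound (c C : R) (n : nat) : R :=
  c * n%:R / ((2 : R) `^ (C * (logstar n)%:R)).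

End LogStar.

Definition good_CCZ_family (F : finFieldType) (R : realType) (c C : R)
  (n k d : nat -> nat) (Q : forall t, 'I_3 -> css_pair F (n t)) : Prop :=
  (forall t h, is_css (Q t h)) /\
  (forall t h, css_dim (Q t h) = k t) /\
  (forall t h, css_dist (Q t h) = d t) /\
  (forall t, exists E : 'I_3 -> 'M[F]_(k t, n t),
        (forall h, is_encZ (Q t h) (E h)) /\ supports_CCZ (Q t) E) /\
  (forall N : nat, exists T : nat, forall t, (T <= t)%N -> (N <= n t)%N) /\
  (forall t, rate_bound c C (n t) <= (k t)%:R) /\
  (forall t, rate_bound c C (n t) <= (d t)%:R).

(* Main.v *)
Require Import Defs.
From HB Require Import structures.
From mathcomp Require Import all_boot all_order all_algebra all_fingroup all_solvable all_field.
From mathcomp Require Import all_classical all_reals exp.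
From mathcomp Require Import zify ring.
Import Order.TTheory GRing.Theory Num.Theory.
Local Open Scope ring_scope.

(** Call a triple of linear relations between an [F]-algebra [K] and words of [F^I]
    a scheme of distance [d] when nonzero elements of [K] have only encodings of
    weight at least [d], fewer than [d] symbols of an encoding reveal nothing about
    the encoded element, and every linear functional of a product [x y z] is a
    weighted sum of coordinatewise products of encodings.  Dividing by the encodings
    of [0] turns a scheme into a triple of CSS codes with a transversal CCZ gate.

    Let [K' = K[X]/f] with [f] irreducible of degree [s].  Polynomials of degree less
    than [2s], read modulo [f] and evaluated at [6s] points of [K], form a scheme for
    [K'] over the alphabet [K], of distance [s]: [f] has no root in [K], so multiples
    of [f] interpolate arbitrary values at fewer than [s] further points, and the
    triple product, of degree less than [6s], is interpolated from its values.
    Concatenation with a scheme for [K] over [F] multiplies lengths by [6s] and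
    distances by [s].  Dually, polynomials interpolated at [s/3] points embed
    [K^(s/3)] into [K'] compatibly with triple products, so the number of logical
    symbols is multiplied by [s/3].  Each level loses a constant factor, and since
    [s] may be exponential in the degree of [K], the number of levels is
    at most [log*] of the length. *)

Set Implicit Arguments. Unset Strict Implicit. Unset Printing Implicit Defensive.

(** * Finite fields of prescribed degree over a finite field *)

Lemma natr_card_finField (K : finFieldType) : #|K|%:R = 0 :> K.
Proof.
by have := expg_cardG (finset.in_setT (1%R : K)); rewrite cardsT FinRing.zmodXgE.
Qed.

(* The argument of [pPrimePowerField], over [K] instead of ['F_p]. *)
Lemma finField_ext_exists (K : finFieldType) (s : nat) : (0 < s)%N ->
  exists L : fieldExtType K, \dim {:L} = s.
Proof.
move=> s_gt0; pose m := (#|K| ^ s)%N.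
have K_gt1 : (1 < #|K|)%N := finNzRing_gt1 K.
have m_gt1 : (1 < m)%N by rewrite (ltn_exp2l 0).
have m1_gt0 : (0 < m.-1)%N by rewrite -ltnS prednK // ltnW.
pose q (A : nzRingType) : {poly A} := 'X^m - 'X.
have Dq A : q A = ('X^(m.-1) - 1) * ('X - 0).
  by rewrite /q subr0 mulrBl mul1r -exprSr prednK // ltnW.
have /FinSplittingFieldFor[/= L splitLq]: q K != 0.
  by rewrite Dq monic_neq0 ?rpredM ?monicXsubC ?monicXnsubC.
rewrite rmorphB rmorphXn /= map_polyX -/(q L) in splitLq.
pose Fm := FinFieldExtType L; exists L.
have /finField_galois_generator[/= a _ Da]: (1 <= {:L})%VS by apply: sub1v.
pose Em := fixedSpace (a ^+ s)%g; rewrite /= dimv1 expn1 in Da.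
have{splitLq} [zs DqL defL] := splitLq.
have m0 : m%:R = 0 :> L.
  rewrite -(rmorph_nat (in_alg L)) natrX natr_card_finField expr0n gtn_eqF //.
  by rewrite rmorph0.
have Uzs: uniq zs.
  rewrite -separable_prod_XsubC -(eqp_separable DqL) Dq separable_root andbC.
  rewrite /root !hornerE subr_eq0 eq_sym expr0n gtn_eqF ?oner_eq0 //=.
  rewrite cyclotomic.separable_Xn_sub_1 // -subn1 natrB ?(ltnW m_gt1) // subr_eq0.
  by rewrite m0 eq_sym oner_eq0.
have in_zs: zs =i Em.
  move=> z; rewrite -root_prod_XsubC -(eqp_root DqL) (sameP fixedSpaceP eqP).
  rewrite /root !hornerE subr_eq0 /= /m; congr (_ == z).
  elim: (s) => [|i IHi]; first by rewrite gal_id.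
  by rewrite expgSr expnSr exprM IHi galM ?Da ?memvf.
have defEm: Em = {:L}%VS.
  apply/eqP; rewrite eqEsubv subvf -defL -[Em]subfield_closed agenvS //.
  by rewrite subv_add sub1v; apply/span_subvP=> z; rewrite in_zs.
have cardL : #|Fm| = m.
  have /eq_card->: Fm =i zs by move=> z; rewrite in_zs defEm memvf.
  apply: succn_inj; rewrite (card_uniqP _) //= -(size_prod_XsubC _ id).
  by rewrite -(eqp_size DqL) size_polyDl size_polyXn // size_polyN size_polyX.
have := @card_vspacef K Fm (Vector.class L).
by rewrite card_vspace cardL => /eqP; rewrite eqn_exp2l // => /eqP.
Qed.

(* [w] is a root of [f], and [1, w, ..., w^(s-1)] is a basis of [K'] over [K]. *)
Definition simple_ext (K K' : fieldType) (j : K -> K') (f : {poly K}) (w : K') (s : nat) :=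
  [/\ size f = s.+1, (map_poly j f).[w] = 0,
      forall p : {poly K}, (size p <= s)%N -> (map_poly j p).[w] = 0 -> p = 0 &
      forall x, exists2 p : {poly K}, (size p <= s)%N & (map_poly j p).[w] = x].

(** Extensions of finite fields are Galois, hence separable and generated by one element [w]; [f] is
    its minimal polynomial, pulled back to [K]. *)
Lemma simple_ext_exists (K : finFieldType) (s : nat) : (0 < s)%N ->
  exists (K' : finFieldType) (j : {rmorphism K -> K'}) f w, simple_ext j f w s.
Proof.
move=> s_gt0; have [L dimL] := finField_ext_exists K s_gt0.
pose Fm := FinFieldExtType L.
have [w defL] : exists w : FinSplittingFieldType K L, <<1; w>>%VS = {:L}%VS.
  exists (separable_generator 1 {: FinSplittingFieldType K L}).
  rewrite -eq_adjoin_separable_generator ?sub1v //.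
  by have /and3P[] := @finField_galois K (FinSplittingFieldType K L) 1%AS {:_}%AS (sub1v _).
have degw : adjoin_degree (1%AS : {subfield L}) w = s.
  by have := dim_Fadjoin (1%AS : {subfield L}) w; rewrite dimv1 muln1 defL dimL.
exists Fm, (in_alg L : {rmorphism K -> Fm}).
have /polyOver1P[f Df] := minPolyOver (1%AS : {subfield L}) w.
have szf (p : {poly K}) : size (map_poly (in_alg L) p) = size p by rewrite size_map_poly.
exists f, w; split.
- by rewrite -szf -Df size_minPoly degw.
- by rewrite -Df minPolyxx.
- move=> p szp p0; have : minPoly (1%AS : {subfield L}) w %| map_poly (in_alg L) p.
    by apply: minPoly_dvdp; [apply/polyOver1P; exists p | apply/rootP].
  apply: contraTeq => pn0; rewrite gtNdvdp ?map_poly_eq0 //.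
  by rewrite size_minPoly degw szf.
- move=> x; have xL : x \in <<1; w>>%VS by rewrite defL memvf.
  have /polyOver1P[p Dp] := Fadjoin_polyOver (1%AS : {subfield L}) w x.
  exists p; first by rewrite -szf -Dp -degw size_Fadjoin_poly.
  by rewrite -Dp (Fadjoin_poly_eq xL).
Qed.

Section SimpleExt.
Variables (K K' : finFieldType) (j : {rmorphism K -> K'}) (f : {poly K}) (w : K') (s : nat).
Hypothesis ext : simple_ext j f w s.

Lemma simple_ext_card : #|K'| = (#|K| ^ s)%N.
Proof.
case: ext => _ _ inj surj.
rewrite -[s]mul1n -card_mx.
pose g (v : 'rV[K]_s) := (map_poly j (rVpoly v)).[w].
have gi : injective g.
  move=> u v guv; apply/eqP; rewrite -subr_eq0; apply/eqP.
  apply: (can_inj rVpolyK); rewrite linear0; apply: inj; first exact: size_poly.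
  by rewrite linearB rmorphB /= hornerD hornerN; apply/eqP; rewrite subr_eq0; apply/eqP.
rewrite -(card_codom gi); apply: eq_card => x; rewrite inE; symmetry.
apply/codomP; have [p szp <-] := surj x.
by exists (poly_rV p); rewrite /g poly_rV_K.
Qed.

(** A root would split off a linear factor, and [w] would be a root of that factor or of the
    cofactor, both nonzero of size at most [s]. *)
Lemma simple_ext_noroot (a : K) : (1 < s)%N -> f.[a] != 0.
Proof.
move=> s_gt1; case: ext => szf f0 inj _; apply/negP => /factor_theorem[g Dg].
have gn0 : g != 0.
  by apply/eqP => g0; move: szf; rewrite Dg g0 mul0r size_poly0.
have szg : size g = s.
  by apply: succn_inj; rewrite -szf Dg size_Mmonic ?monicXsubC // size_XsubC addn2.
move: f0; rewrite Dg rmorphM hornerM => /eqP; rewrite mulf_eq0 => /orP[] /eqP e0.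
  by move: gn0; rewrite (inj g) ?szg ?eqxx.
by have := polyXsubC_eq0 a; rewrite (inj _ _ e0) ?eqxx // size_XsubC.
Qed.

End SimpleExt.

(** * Lagrange interpolation *)

Section Lagrange.
Variables (K : fieldType) (T : finType) (al : T -> K).
Hypothesis al_inj : injective al.

Definition lagrange (B : {set T}) (i : T) : {poly K} :=
  \prod_(k in B :\ i) ((al i - al k)^-1 *: ('X - (al k)%:P)).

Lemma size_lagrange (B : {set T}) i : i \in B -> (size (lagrange B i) <= #|B|)%N.
Proof.
move=> iB; rewrite (cardsD1 i) iB /lagrange scaler_prod.
by rewrite (leq_trans (size_scale_leq _ _)) //
  -big_enum size_prod_XsubC -cardE.
Qed.

Lemma horner_lagrange (B : {set T}) i k : k \in B -> (lagrange B i).[al k] = (i == k)%:R.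
Proof.
move=> kB; rewrite horner_prod; have [->|nik] := eqVneq i k.
  rewrite big1 // => m; rewrite !inE => /andP[nmk _].
  by rewrite !hornerE mulVf // subr_eq0 (inj_eq al_inj) eq_sym.
by rewrite (bigD1 k) ?inE ?kB 1?eq_sym ?nik //= !hornerE subrr mulr0 mul0r.
Qed.

Lemma interpolate (B : {set T}) (y : T -> K) :
  exists2 g : {poly K}, (size g <= #|B|)%N & {in B, forall i, g.[al i] = y i}.
Proof.
exists (\sum_(i in B) y i *: lagrange B i).
  apply: (leq_trans (size_sum _ _ _)); apply/bigmax_leqP => i iB.
  by rewrite (leq_trans (size_scale_leq _ _)) // size_lagrange.
move=> k kB; rewrite horner_sum (bigD1 k) //= hornerZ horner_lagrange // eqxx mulr1.
rewrite big1 ?addr0 // => i /andP[_ nik].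
by rewrite hornerZ horner_lagrange // (negPf nik) mulr0.
Qed.

Lemma card_roots_lt (p : {poly K}) D : p != 0 -> (size p <= D)%N ->
  (#|[set i | p.[al i] == 0%R]| < D)%N.
Proof.
move=> pn0 szp; rewrite cardE -(size_map al); apply: leq_trans szp.
apply: max_poly_roots => //; last by rewrite map_inj_uniq ?enum_uniq.
by apply/allP => _ /mapP[i + ->]; rewrite mem_enum inE.
Qed.

(** The difference of the two sides vanishes at all [#|T|] nodes, too many roots for its size. *)
Lemma lagrange_expand (p : {poly K}) : (size p <= #|T|)%N ->
  p = \sum_i p.[al i] *: lagrange [set: T] i.
Proof.
move=> szp; set q := \sum_i _; apply/eqP; rewrite -subr_eq0.
apply: contraT => pq; have H := @card_roots_lt _ #|T| pq.
have szq : (size q <= #|T|)%N.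
  apply: (leq_trans (size_sum _ _ _)); apply/bigmax_leqP => i iB.
  by rewrite (leq_trans (size_scale_leq _ _)) // -cardsT size_lagrange.
have /H: (size (p - q)%R <= #|T|)%N.
  by rewrite (leq_trans (size_polyD _ _)) // geq_max szp size_polyN szq.
rewrite -cardsT ltnNge subset_leq_card //; apply/fintype.subsetP => k _.
rewrite inE hornerD hornerN horner_sum (bigD1 k) //= hornerZ horner_lagrange // eqxx mulr1.
rewrite big1 ?addr0 ?subrr // => i nik.
by rewrite hornerZ horner_lagrange // (negPf nik) mulr0.
Qed.
End Lagrange.

(** Since [size] is degree plus one, three factors of size [D] give size at most [3 * D - 2]. *)
Lemma size_polyM3_leq (K : fieldType) (p q r : {poly K}) D N :
  (size p <= D)%N -> (size q <= D)%N -> (size r <= D)%N -> (3 * D <= N + 2)%N ->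
  (size (p * q * r)%R <= N)%N.
Proof.
by move=> ? ? ? ?; have := size_polyMleq p q; have := size_polyMleq (p * q) r; lia.
Qed.

Lemma sumn_card_fiber (A B : finType) (P : pred (A * B)) :
  #|[set u | P u]| = (\sum_a #|[set b | P (a, b)]|)%N.
Proof.
rewrite -sum1_card (eq_bigl P) => [|u]; last by rewrite inE.
under [RHS]eq_bigr => a _ do
  [rewrite -sum1_card (eq_bigl (fun b => P (a, b))) => [|b]; last by rewrite inE].
by rewrite pair_big_dep /=; apply: eq_bigl => -[].
Qed.

(** * Multiplication schemes *)

Section Schemes.
Variable F : finFieldType.

Definition F_linear (K : finFieldType) (iota : {rmorphism F -> K}) (l : K -> F) :=
  forall a x y, l (iota a * x + y) = a * l x + l y.

(** A relation rather than a map: an element has many encodings, which for a linear relation form a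
    coset of those of 0. *)
Definition scheme (K : finFieldType) (I : finType) := K -> (I -> F) -> Prop.

(* [ms_dist] bounds the distance against Z logical operators and [ms_priv] the one
   against X logical operators: an operator supported on [J] cannot detect the
   encoded element. *)
Record mult_scheme (K : finFieldType) (iota : {rmorphism F -> K}) (I : finType)
    (d : nat) (Enc : 'I_3 -> scheme K I) : Prop := MultScheme {
  ms_lin : forall h a x y v w, Enc h x v -> Enc h y w ->
    Enc h (iota a * x + y) (fun i => a * v i + w i);
  ms_total : forall h x, exists v, Enc h x v;
  ms_dist : forall h x v, Enc h x v -> x != 0 -> (d <= #|[set i | v i != 0%R]|)%N;
  ms_priv : forall h x v x' (J : {set I}), (#|J| < d)%N -> Enc h x v ->
    exists2 v', Enc h x' v' & {in J, v' =1 v};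
  ms_mult : forall l, F_linear iota l -> exists b : I -> F,
    forall x v, (forall h, Enc h (x h) (v h)) ->
      l (x 0 * x 1 * x 2) = \sum_i b i * v 0 i * v 1 i * v 2 i }.

Section FLinear.
Variables (K : finFieldType) (iota : {rmorphism F -> K}) (l : K -> F).
Hypothesis l_lin : F_linear iota l.

Lemma F_linearD x y : l (x + y) = l x + l y.
Proof. by have := l_lin 1 x y; rewrite rmorph1 !mul1r. Qed.

Lemma F_linear0 : l 0 = 0.
Proof. by apply: (addIr (l 0)); rewrite -F_linearD !add0r. Qed.

Lemma F_linearZ a x : l (iota a * x) = a * l x.
Proof. by have := l_lin a x 0; rewrite !addr0 F_linear0 addr0. Qed.

Lemma F_linear_sum (T : finType) (P : pred T) (u : T -> K) :
  l (\sum_(i | P i) u i) = \sum_(i | P i) l (u i).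
Proof. exact: (big_morph l F_linearD F_linear0). Qed.
End FLinear.

(** * One level: concatenation with polynomial codes *)

Section Step.
Variables (K K' : finFieldType) (iota : {rmorphism F -> K}) (j : {rmorphism K -> K'}).
Variables (f : {poly K}) (w : K') (s : nat).
Hypothesis ext : simple_ext j f w s.
Hypothesis s_gt1 : (1 < s)%N.
Local Notation iota' := (j \o iota : {rmorphism F -> K'}).
Local Notation ev p := ((map_poly j p).[w]).

(** Reed-Solomon code outside, [Enc] inside. The polynomial [p] need not be reduced modulo [f]: the
    freedom to add multiples of [f] is what hides [x]. *)
Definition rs_concat (I T : finType) (D : nat) (al : T -> K) (Enc : scheme K I) :
    scheme K' (T * I)%type :=
  fun x v => exists p : {poly K}, [/\ (size p <= D)%N, ev p = x &
    forall i, Enc p.[al i] (fun t => v (i, t))].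

(** The four inequalities say in turn: a triple product is determined by its values at the points; a
    nonzero polynomial is nonzero at [d1] points or more; [f * g] has size at most [D] when [g] has
    size below [d1]; every element has a representative. *)
Lemma rs_concat_mult_scheme (I T : finType) (D d d1 : nat) (al : T -> K)
    (Enc : 'I_3 -> scheme K I) :
  injective al -> (3 * D <= #|T| + 2)%N -> (D + d1 <= #|T|.+1)%N -> (s + d1 <= D.+1)%N ->
  (s <= D)%N ->
  mult_scheme iota d Enc ->
  mult_scheme iota' (d1 * d) (fun h => rs_concat D al (Enc h)).
Proof.
move=> al_inj D3 Dd1 sd1 sD ms; have [szf f0 _ surj] := ext; split.
- move=> h a _ _ v1 v2 [p [szp <- Hp]] [q [szq <- Hq]].
  exists (iota a *: p + q); split.
  + rewrite (leq_trans (size_polyD _ _)) // geq_max szq andbT.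
    by rewrite (leq_trans (size_scale_leq _ _)).
  + by rewrite rmorphD /= map_polyZ hornerD hornerZ.
  + by move=> i; rewrite hornerD hornerZ; apply: (ms_lin ms).
- move=> h x; have [p szp <-] := surj x.
  have /fin_all_exists[v Hv] i := ms_total ms h p.[al i].
  exists (fun it => v it.1 it.2), p; split => //; exact: leq_trans szp sD.
- move=> h x v [p [szp <- Hp]] evp.
  have pn0 : p != 0 by apply: contraNneq evp => ->; rewrite rmorph0 horner0.
  pose A := [set i | p.[al i] == 0].
  have ltD : (#|A| < D)%N := card_roots_lt al_inj pn0 szp.
  rewrite (sumn_card_fiber (fun u => v u != 0)).
  rewrite (bigID (fun i => p.[al i] == 0)) /= (leq_trans _ (leq_addl _ _)) //.
  apply: (@leq_trans (\sum_(i | p.[al i] != 0%R) d)); last first.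
    by apply: leq_sum => i pi; apply: (ms_dist ms (Hp i) pi).
  rewrite sum_nat_const leq_mul2r; apply/orP; right.
  rewrite [X in (_ <= X)%N](_ : _ = #|~: A|); last by apply: eq_card => i; rewrite !inE.
  by have := cardsC A; move: ltD Dd1; lia.
- move=> h _ v x' J ltJ [p [szp _ Hp]].
  pose Jf i := [set t | (i, t) \in J].
  (* In the blocks of [B] the set [J] sees at least [d] symbols; there are fewer than [d1] of them
     because [#|J| < d1 * d]. *)
  pose B := [set i | d <= #|Jf i|]%N.
  have ltB : (#|B| < d1)%N.
    rewrite ltnNge; apply: contraTN ltJ => leB; rewrite -leqNgt.
    have -> : J = [set u | u \in J] by apply/setP => u; rewrite inE.
    rewrite (sumn_card_fiber (fun u => u \in J)).
    rewrite (bigID (mem B)) /= (leq_trans _ (leq_addr _ _)) //.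
    apply: (@leq_trans (\sum_(i in B) d)); last first.
      by apply: leq_sum => i; rewrite inE.
    by rewrite sum_nat_const leq_mul2r leB orbT.
  have [p0 szp0 evp0] := surj (x' - ev p).
  have fn0 i : f.[al i] != 0 := simple_ext_noroot ext (al i) s_gt1.
  (* The multiple [f * g] cancels [p0] on [B], so [p'] represents [x'] and keeps the values of [p]
     on [B]; inner privacy handles the other blocks. *)
  have [g szg Hg] := interpolate al_inj B (fun i => - p0.[al i] / f.[al i]).
  pose p' := p + (p0 + f * g).
  have agree i : i \in B -> p'.[al i] = p.[al i].
    by move=> iB; rewrite hornerD hornerD hornerM Hg // [f.[_] * _]mulrC divfK // subrr addr0.
  have Hv i : exists v', Enc h p'.[al i] v' /\ {in Jf i, v' =1 fun t => v (i, t)}.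
    have [/agree->|] := boolP (i \in B); first by exists (fun t => v (i, t)).
    rewrite inE -ltnNge => lti.
    by have [v' ? ?] := ms_priv ms p'.[al i] lti (Hp i); exists v'.
  have [v' Hv'] := fin_all_exists Hv.
  exists (fun it => v' it.1 it.2); last first.
    by move=> [i t] itJ /=; have [_ ->] := Hv' i; rewrite ?inE.
  exists p'; split.
  + rewrite (leq_trans (size_polyD _ _)) // geq_max szp /=.
    rewrite (leq_trans (size_polyD _ _)) // geq_max (leq_trans szp0 sD) /=.
    rewrite (leq_trans (size_polyMleq _ _)) // szf /=.
    have szg' : (size g < d1)%N by apply: leq_ltn_trans ltB.
    by rewrite -ltnS (leq_trans _ sd1) // -addnS leq_add2l.
  + by rewrite !rmorphD rmorphM /= !hornerD hornerM f0 mul0r addr0 evp0 addrC subrK.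
  + by move=> i; have [] := Hv' i.
(* Interpolation writes [l] of the product as a sum over blocks of functionals [li i] on [K], each
   covered by the inner scheme. *)
- move=> l l_lin; pose L i := ev (lagrange al [set: T] i).
  pose li i y := l (j y * L i).
  have li_lin i : F_linear iota (li i).
    by move=> a x y; rewrite /li rmorphD rmorphM mulrDl -mulrA; apply: l_lin.
  have [b Hb] := fin_all_exists (fun i => ms_mult ms (li_lin i)).
  exists (fun it => b it.1 it.2) => x v Hx.
  have [p Hp] := fin_all_exists Hx.
  have evp h : x h = ev (p h) by have [_ ->] := Hp h.
  pose q := p 0 * p 1 * p 2.
  have szq : (size q <= #|T|)%N.
    have szp h : (size (p h) <= D)%N by have [] := Hp h.
    exact: (size_polyM3_leq (szp 0) (szp 1) (szp 2) D3).
  have -> : x 0 * x 1 * x 2 = \sum_i j q.[al i] * L i.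
    rewrite !evp -!hornerM -!rmorphM /= -/q {1}(lagrange_expand al_inj szq).
    rewrite rmorph_sum horner_sum; apply: eq_bigr => i _.
    by rewrite /= map_polyZ hornerZ.
  transitivity (\sum_i \sum_t b i t * v 0 (i, t) * v 1 (i, t) * v 2 (i, t)); last first.
    by rewrite pair_bigA; apply: eq_bigr => -[].
  rewrite (F_linear_sum l_lin).
  apply: eq_bigr => i _; rewrite -/(li i _) /q !hornerM.
  by apply: (Hb i (fun h => (p h).[al i]) (fun h t => v h (i, t))) => h; have [] := Hp h.
Qed.

(* Reverse multiplication-friendly embedding: [z |-> \sum_a iota (z a) * e a]
   turns triple products in [K], read through [l], into coordinatewise triple products. *)
Definition orth_system (L : finFieldType) (io : {rmorphism F -> L}) (J : finType) :=
  exists (e : J -> L) (l : L -> F), F_linear io l /\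
    forall a b c, l (e a * e b * e c) = ((a == b) && (b == c))%:R.

(** A product of three of the new elements has a representative of size at most [s], so its node
    values can be read off. At node [c] it vanishes unless all three Lagrange indices are [c], and
    then the old [l] tests the remaining indices. *)
Lemma orth_system_ext (J T : finType) (be : T -> K) :
  injective be -> (3 * #|T| <= s + 2)%N ->
  orth_system iota J -> orth_system iota' (T * J)%type.
Proof.
move=> be_inj leT [e [l [l_lin l_orth]]]; have [_ _ inj surj] := ext.
have Hx x : exists p : {poly K}, (size p <= s)%N /\ ev p = x.
  by have [p] := surj x; exists p.
have [px Hpx] := fin_all_exists Hx.
(* Reduced representatives are unique; this also makes the functional below linear. *)
have pxE (p : {poly K}) : (size p <= s)%N -> px (ev p) = p.
  move=> szp; have [sz e1] := Hpx (ev p); apply/eqP; rewrite -subr_eq0; apply/eqP/inj.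
    by rewrite (leq_trans (size_polyD _ _)) // geq_max sz size_polyN szp.
  by rewrite rmorphB /= hornerD hornerN e1 subrr.
exists (fun u => ev (e u.2 *: lagrange be [set: T] u.1)).
exists (fun x => \sum_c l (px x).[be c]); split.
  move=> a x y; rewrite mulr_sumr -big_split /=; apply: eq_bigr => c _.
  have [szx evx] := Hpx x; have [szy evy] := Hpx y.
  rewrite (_ : px _ = iota a *: px x + px y); first by rewrite hornerD hornerZ l_lin.
  rewrite -{1}evx -{1}evy -hornerZ -map_polyZ -hornerD -rmorphD pxE //.
  rewrite (leq_trans (size_polyD _ _)) // geq_max szy andbT.
  by rewrite (leq_trans (size_scale_leq _ _)).
move=> [a1 i1] [a2 i2] [a3 i3] /=; rewrite -!hornerM -!rmorphM /=.
set La := lagrange be [set: T].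
have szL a i : (size (e i *: La a) <= #|T|)%N.
  by rewrite (leq_trans (size_scale_leq _ _)) // -cardsT size_lagrange.
rewrite pxE; last first.
  exact: (size_polyM3_leq (szL a1 i1) (szL a2 i2) (szL a3 i3) leT).
have val c : (e i1 *: La a1 * (e i2 *: La a2) * (e i3 *: La a3)).[be c] =
    if [&& a1 == c, a2 == c & a3 == c] then e i1 * e i2 * e i3 else 0.
  rewrite !hornerM !hornerZ !horner_lagrange ?inE //.
  by do 3!case: eqP => _; rewrite /= ?(mulr0, mul0r, mulr1).
rewrite (bigD1 a1) //= big1 ?addr0 => [|c ca1]; last first.
  by rewrite val [a1 == c]eq_sym (negPf ca1) (F_linear0 l_lin).
rewrite val eqxx /= !xpair_eqE [a2 == a1]eq_sym.
case: (eqVneq a1 a2) => [<-|_] /=; last by rewrite (F_linear0 l_lin).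
rewrite [a3 == a1]eq_sym; case: (eqVneq a1 a3) => [_|_] /=.
  by rewrite l_orth.
by rewrite (F_linear0 l_lin) andbF.
Qed.

End Step.
End Schemes.

(** * Base schemes and the recursive levels *)

Section Base.
Variable F : finFieldType.
Local Notation idF := (idfun : {rmorphism F -> F}).

Definition id_scheme : scheme F F unit := fun x v => v tt = x.

Lemma id_mult_scheme : mult_scheme idF 1 (fun=> id_scheme).
Proof.
split.
- by move=> _ a x y v w; rewrite /id_scheme => -> ->.
- by move=> _ x; exists (fun=> x).
- move=> _ x v vx xn0; rewrite card_gt0; apply/set0Pn; exists tt.
  by rewrite inE vx.
- move=> _ x v x' J; rewrite ltnS leqn0 cards_eq0 => /eqP-> _.
  by exists (fun=> x') => // i; rewrite inE.
- move=> l l_lin; exists (fun=> l 1) => x v Hv.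
  rewrite (bigD1 tt) //= big1 ?addr0; last by case.
  rewrite -[LHS]/(l _) -[_ * _ * _]mulr1 (F_linearZ l_lin).
  by rewrite !Hv mulrC !mulrA.
Qed.

Lemma id_orth_system : orth_system idF unit.
Proof.
exists (fun=> 1), id; split=> [a x y //|[] [] []].
by rewrite !mulr1 !eqxx.
Qed.

Section Cube.
Variables (K : finFieldType) (iota : {rmorphism F -> K}) (f : {poly F}) (w : K) (s : nat).
Hypothesis ext : simple_ext iota f w s.

Definition cube_index := ('I_s * 'I_s * 'I_s)%type.

Definition cube_proj (h : 'I_3) (t : cube_index) : 'I_s :=
  if h == 0 then t.1.1 else if h == 1 then t.1.2 else t.2.

(* The [s ^ 3] physical symbols let the tensor of [l (x * y * z)] be written
   in coordinates; the three codes differ by a permutation of the positions. *)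
Definition cube_scheme (h : 'I_3) : scheme F K cube_index := fun x v =>
  exists p : {poly F}, [/\ (size p <= s)%N, (map_poly iota p).[w] = x &
    forall t, v t = p`_(cube_proj h t)].

(** The transposition of axes [0] and [h]; it matches scheme [h] with scheme [0], so that the three
    distances will coincide. *)
Definition cube_perm (h : 'I_3) (t : cube_index) : cube_index :=
  if h == 0 then t else if h == 1 then (t.1.2, t.1.1, t.2) else (t.2, t.1.2, t.1.1).

Lemma cube_permK h : involutive (cube_perm h).
Proof. by move=> [[a b] c]; rewrite /cube_perm; case: (h == 0); case: (h == 1). Qed.

Lemma cube_proj_perm h t : cube_proj 0 (cube_perm h t) = cube_proj h t.
Proof. by rewrite /cube_perm /cube_proj eqxx; case: (h == 0); case: (h == 1). Qed.

Lemma cube_scheme_perm h x v :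
  cube_scheme h x v <-> cube_scheme 0 x (v \o cube_perm h).
Proof.
split=> -[p [szp evp Hv]]; exists p; split=> // t.
  by rewrite /= Hv -cube_proj_perm cube_permK.
by have := Hv (cube_perm h t); rewrite /= cube_permK cube_proj_perm.
Qed.

(** Expanding the factors in powers of [w] turns [l] of a triple product into a sum indexed by the
    cube. At distance 1, privacy concerns only the empty [J]. *)
Lemma cube_mult_scheme : mult_scheme iota 1 cube_scheme.
Proof.
have [_ _ _ surj] := ext; split.
- move=> h a _ _ v1 v2 [p [szp <- Hp]] [q [szq <- Hq]].
  exists (a *: p + q); split.
  + rewrite (leq_trans (size_polyD _ _)) // geq_max szq andbT.
    by rewrite (leq_trans (size_scale_leq _ _)).
  + by rewrite rmorphD /= map_polyZ hornerD hornerZ.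
  + by move=> t; rewrite coefD coefZ Hp Hq.
- move=> h x; have [p szp evp] := surj x.
  by exists (fun t => p`_(cube_proj h t)), p.
- move=> h x v [p [szp evp Hp]] xn0; rewrite card_gt0; apply/set0Pn.
  have pn0 : p != 0 by apply: contraNneq xn0 => p0; rewrite -evp p0 rmorph0 horner0.
  have lts : ((size p).-1 < s)%N by rewrite prednK ?size_poly_gt0.
  (* On the diagonal every [cube_proj h] gives [a], so this position shows the leading coefficient
     of [p]. *)
  pose a := Ordinal lts; exists (a, a, a); rewrite inE Hp.
  rewrite (_ : cube_proj h _ = a); last by rewrite /cube_proj; case: (h == 0); case: (h == 1).
  by rewrite -[X in X != _]/(lead_coef p) lead_coef_eq0.
- move=> h x v x' J; rewrite ltnS leqn0 cards_eq0 => /eqP-> _.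
  have [p szp evp] := surj x'.
  exists (fun t => p`_(cube_proj h t)) => [|i]; last by rewrite inE.
  by exists p.
- move=> l l_lin; exists (fun t : cube_index => l (w ^+ t.1.1 * w ^+ t.1.2 * w ^+ t.2)) => x v Hx.
  have [p Hp] := fin_all_exists Hx.
  have xE h : x h = \sum_(a < s) iota (p h)`_a * w ^+ a.
    have [szp <- _] := Hp h.
    by rewrite (@horner_coef_wide _ s) ?size_map_poly //; apply: eq_bigr => a _; rewrite coef_map.
  rewrite !xE big_distrlr /= mulr_suml.
  transitivity (\sum_(a < s) \sum_(b < s) \sum_(c < s)
     l (w ^+ a * w ^+ b * w ^+ c) * (p 0)`_a * (p 1)`_b * (p 2)`_c); last first.
    rewrite pair_bigA pair_bigA; apply: eq_bigr => -[[a b] c] _ /=.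
    by have [_ _ ->] := Hp 0; have [_ _ ->] := Hp 1; have [_ _ ->] := Hp 2.
  rewrite (F_linear_sum l_lin); apply: eq_bigr => a _.
  rewrite mulr_suml (F_linear_sum l_lin); apply: eq_bigr => b _.
  rewrite mulr_sumr (F_linear_sum l_lin); apply: eq_bigr => c _.
  rewrite [X in l X](_ : _ = iota ((p 0)`_a * (p 1)`_b * (p 2)`_c) * (w ^+ a * w ^+ b * w ^+ c)).
    by rewrite (F_linearZ l_lin) mulrC !mulrA.
  by rewrite !rmorphM; ring.
Qed.
End Cube.

(* [tow t] is the distance at level [t]; the extension degree [3 * 2 ^ (tow t).-1] is
   large enough for [2 ^ tow t <= tow t.+1], while [18 ^ tow t <= #|K|] leaves room
   for its [6 * 3 * 2 ^ (tow t).-1] evaluation points. *)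
Fixpoint tow (t : nat) : nat :=
  if t is t'.+1 then (tow t' * (3 * 2 ^ (tow t').-1))%N else 1%N.

Lemma tow_gt0 t : (0 < tow t)%N.
Proof. by elim: t => //= t IH; rewrite !muln_gt0 IH expn_gt0. Qed.

Lemma exists_injection (T : finType) n : (n <= #|T|)%N ->
  exists al : 'I_n -> T, injective al.
Proof.
move=> le_n; exists (fun i => enum_val (widen_ord le_n i)) => i k /enum_val_inj e.
by apply: val_inj; have /(congr1 val) := e.
Qed.

(** [m0] is the length at level 0 and [J] indexes the logical symbols. Relative to the distance,
    each level costs a factor 6 in length and 3 in dimension. The injections [g] serve to equate the
    three distances. *)
Definition code_level (sym : bool) (m0 t : nat) : Prop :=
  exists (K : finFieldType) (iota : {rmorphism F -> K}) (I J : finType)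
    (Enc : 'I_3 -> scheme F K I),
  [/\ (18 ^ tow t <= #|K|)%N /\ mult_scheme iota (tow t) Enc,
      #|I| = (m0 * 6 ^ t * tow t)%N,
      (#|J| * 3 ^ t = tow t)%N /\ orth_system iota J,
      forall h, exists2 g : I -> I, injective g &
        forall x v, Enc h x v <-> Enc 0 x (v \o g) &
      sym -> forall h, Enc h = Enc 0].

(** Degree 5 suffices for every [F], as [2 ^ 5] exceeds 18; the cube then has [5 ^ 3 = 125]
    positions. *)
Lemma code_level0 : code_level false 125 0.
Proof.
have [K [iota [f [w ext]]]] := simple_ext_exists F (isT : (0 < 5)%N).
have be_inj : injective (fun _ : 'I_1 => 0 : F) by move=> i k _; rewrite !ord1.
exists K, iota, (cube_index 5), ('I_1 * unit)%type, (cube_scheme iota w (s := 5)).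
split=> //.
- split; last exact: cube_mult_scheme ext.
  rewrite (simple_ext_card ext) expn1 (leq_trans (_ : 18 <= 2 ^ 5)%N) // leq_exp2r //.
  exact: finNzRing_gt1.
- by rewrite !card_prod !card_ord.
- rewrite !card_prod card_ord card_unit; split=> //.
  have le15 : (3 * #|'I_1| <= 5 + 2)%N by rewrite card_ord.
  have [e [l [l_lin l_orth]]] := orth_system_ext ext be_inj le15 id_orth_system.
  by exists e, l.
- move=> h; exists (@cube_perm 5 h); first exact: inv_inj (cube_permK _).
  exact: cube_scheme_perm.
Qed.

(** Products of three polynomials of degree at most 1 are determined by 4 points of [F], and [5 ^ 2]
    exceeds 18. One polynomial code serves all [h], whence the symmetry. *)
Lemma sym_code_level0 : (5 <= #|F|)%N -> code_level true 4 0.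
Proof.
move=> F5; have [K [iota [f [w ext]]]] := simple_ext_exists F (isT : (0 < 2)%N).
have [al al_inj] := exists_injection (ltnW F5).
have be_inj : injective (fun _ : 'I_1 => 0 : F) by move=> i k _; rewrite !ord1.
pose Enc (h : 'I_3) := rs_concat iota w 2 al id_scheme.
exists K, (iota \o idF), ('I_4 * unit)%type, ('I_1 * unit)%type, Enc; split=> //.
- split.
    rewrite (simple_ext_card ext) expn1 (leq_trans (_ : 18 <= 5 ^ 2)%N) // leq_exp2r //.
  have := rs_concat_mult_scheme (D := 2) (d1 := 1) ext isT al_inj _ _ _ _ id_mult_scheme.
  by rewrite card_ord; apply.
- by rewrite card_prod card_unit card_ord.
- rewrite !card_prod card_ord card_unit; split=> //.
  apply: (orth_system_ext ext be_inj _ id_orth_system) => //.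
  by rewrite card_ord.
- by move=> h; exists id.
Qed.

Lemma code_levelS sym m0 t : code_level sym m0 t -> code_level sym m0 t.+1.
Proof.
case=> K [iota [I [J [Enc [[cardK ms] cardI [cardJ orth] iso eqs]]]]].
pose P := tow t; pose s := (3 * 2 ^ P.-1)%N.
have P_gt0 : (0 < P)%N := tow_gt0 t.
have p2 : (0 < 2 ^ P.-1)%N by rewrite expn_gt0.
have s_gt1 : (1 < s)%N by rewrite /s; lia.
have le6s : (6 * s <= #|K|)%N.
  apply: leq_trans cardK; rewrite -/P -(prednK P_gt0) expnS /s mulnA leq_mul //.
  by case: P.-1 => // m; rewrite leq_exp2r.
have [al al_inj] := exists_injection le6s.
have [be be_inj] : exists be : 'I_(2 ^ P.-1) -> K, injective be.
  by apply: exists_injection; apply: leq_trans le6s; rewrite /s; lia.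
have [K' [j [f [w ext]]]] := simple_ext_exists K (ltnW s_gt1).
exists K', (j \o iota), ('I_(6 * s) * I)%type, ('I_(2 ^ P.-1) * J)%type.
(* With [D = 2 * s] and [d1 = s], triple products have size below the number [6 * s] of points. *)
exists (fun h => rs_concat j w (2 * s) al (Enc h)); split.
- split.
    by rewrite (simple_ext_card ext) /= -/P -/s expnM leq_exp2r //; lia.
  rewrite (_ : tow t.+1 = s * P)%N; last by rewrite mulnC.
  by apply: (rs_concat_mult_scheme ext s_gt1 al_inj) ms; rewrite ?card_ord; lia.
- by rewrite card_prod card_ord cardI /= -/P -/s expnS; lia.
- split; last by apply: (orth_system_ext ext be_inj) => //; rewrite card_ord /s; lia.
  rewrite card_prod card_ord expnS; transitivity (#|J| * 3 ^ t * s)%N; last by rewrite cardJ.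
  by rewrite /s; move: (2 ^ _)%N (3 ^ t)%N => u v; lia.
- move=> h; have [g g_inj Hg] := iso h.
  exists (fun u => (u.1, g u.2)); first by move=> [i u] [i' u'] [-> /g_inj->].
  move=> x v; split=> -[p [szp evp Hp]]; exists p; split=> // i.
    by have /Hg := Hp i.
  by apply/Hg; apply: Hp.
- by move=> /eqs e h; rewrite e.
Qed.
End Base.

(** * Orthogonal complements *)

Section Dual.
Variables (F : finFieldType) (n : nat).
Implicit Types (x y u v : 'rV[F]_n) (U : {vspace 'rV[F]_n}).

(** A predicate closed under linear combinations is its own span; this gives membership tests for
    [dualv], [rel_stab] and [QZ]. *)
Lemma mem_span_enum (p : pred 'rV[F]_n) : p 0 ->
  (forall a u v, p u -> p v -> p (a *: u + v)) ->
  forall v, (v \in <<[seq v <- enum 'rV[F]_n | p v]>>%VS) = p v.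
Proof.
move=> p0 pD v; apply/idP/idP => [|pv]; last first.
  by apply: memv_span; rewrite mem_filter pv mem_enum.
move=> vX; rewrite (coord_span (X := in_tuple _) vX).
elim/big_rec: _ => // i u _ pu; apply: pD => //.
have : ([seq v <- enum 'rV[F]_n | p v])`_i \in [seq v <- enum 'rV[F]_n | p v].
  by apply: mem_nth.
by rewrite mem_filter => /andP[].
Qed.

Lemma dotvC x y : dotv x y = dotv y x.
Proof. by apply: eq_bigr => i _; rewrite mulrC. Qed.

Lemma dotvDl a x y u : dotv (a *: x + y) u = a * dotv x u + dotv y u.
Proof.
rewrite /dotv mulr_sumr -big_split; apply: eq_bigr => i _ /=.
by rewrite !mxE mulrDl mulrA.
Qed.

Lemma dotvE x y : dotv x y = (x *m y^T) 0 0.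
Proof. by rewrite mxE; apply: eq_bigr => i _; rewrite mxE. Qed.

Lemma mem_dualv U x : reflect (forall y, y \in U -> dotv x y = 0) (x \in dualv U).
Proof.
rewrite /dualv mem_span_enum.
- apply: (iffP forallP) => H y; first by move=> yU; have /implyP/(_ yU)/eqP := H y.
  by apply/implyP => /H->.
- by apply/forallP => y; apply/implyP => _; rewrite dotvE mul0mx mxE.
- move=> a u v /forallP Hu /forallP Hv; apply/forallP => y; apply/implyP => yU.
  by rewrite dotvDl (eqP (implyP (Hu y) yU)) (eqP (implyP (Hv y) yU)) mulr0 addr0.
Qed.

(** For a matrix [B] whose rows span [U], the columns of [cokermx B] lie in the dual of [U], and
    orthogonality to them characterizes the row space. *)
Lemma dualvK U : dualv (dualv U) = U.
Proof.
apply/vspaceP => x; apply/mem_dualv/idP => [Hx | xU y /mem_dualv Hy]; last first.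
  by rewrite dotvC Hy.
pose B := \matrix_(i < \dim U) (vbasis U)`_i.
have memB v : (v <= B)%MS = (v \in U).
  apply/submxP/idP => [[c ->]|vU].
    rewrite mulmx_sum_row memv_suml // => i _; rewrite memvZ // rowK.
    by apply: vbasis_mem; apply: mem_nth; rewrite size_tuple.
  exists (\row_i coord (vbasis U) i v); rewrite mulmx_sum_row {1}(coord_vbasis vU).
  by apply: eq_bigr => i _; rewrite mxE rowK.
rewrite -memB submxE; apply/eqP/rowP => c; rewrite mxE [RHS]mxE.
have /Hx : (col c (cokermx B))^T \in dualv U.
  apply/mem_dualv => y; rewrite -memB submxE => /eqP/rowP/(_ c).
  rewrite !mxE => e; rewrite dotvC -[RHS]e; apply: eq_bigr => i _; by rewrite !mxE.
by move=> e; rewrite -[RHS]e; apply: eq_bigr => i _; rewrite !mxE.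
Qed.
End Dual.

(* [minn] with the default value [n] is not a monoid law, so [css_dist] is compared
   through its lower bounds instead of by reindexing. *)
Lemma leq_css_dist (F : finFieldType) n (Q : css_pair F n) m :
  (m <= css_dist Q)%N =
  (m <= n)%N && [forall y, css_logical Q y ==> (m <= wt y)%N].
Proof.
transitivity ((m <= n)%N && all (fun y => css_logical Q y ==> (m <= wt y)%N)
                                (index_enum 'rV[F]_n)).
  rewrite /css_dist; elim: index_enum => [|y r IH]; first by rewrite big_nil andbT.
  by rewrite big_cons /=; case: (css_logical Q y); rewrite //= leq_min IH andbCA.
congr (_ && _); apply/allP/forallP => H y //.
by apply: H; apply: mem_index_enum.
Qed.

(** * From linear relations to CSS codes *)

Section Relation.
Variables (F : finFieldType) (n k d : nat).

Record mult_relation (R : 'I_3 -> 'rV[F]_k -> 'rV[F]_n -> Prop) : Prop := MultRelation {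
  mr_lin : forall h a z z' v v', R h z v -> R h z' v' -> R h (a *: z + z') (a *: v + v');
  mr_total : forall h z, exists v, R h z v;
  mr_dist : forall h z v, R h z v -> z != 0 -> (d <= wt v)%N;
  mr_priv : forall h z v z' (J : {set 'I_n}), (#|J| < d)%N -> R h z v ->
    exists2 v', R h z' v' & {in J, forall i, v' 0 i = v 0 i};
  mr_mult : exists b : 'rV[F]_n, forall z v, (forall h, R h (z h) (v h)) ->
    \sum_i z 0 0 i * z 1 0 i * z 2 0 i = \sum_i b 0 i * v 0 0 i * v 1 0 i * v 2 0 i }.

Variable R : 'I_3 -> 'rV[F]_k -> 'rV[F]_n -> Prop.
Hypothesis mr : mult_relation R.

Definition rel_stab h : {vspace 'rV[F]_n} :=
  <<[seq v <- enum 'rV[F]_n | `[< R h 0 v >]]>>%VS.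

(** [QX] is taken as a dual so that its own dual is the space of encodings of 0, by biduality. *)
Definition rel_css h : css_pair F n :=
  CSS (dualv (rel_stab h)) <<[seq v <- enum 'rV[F]_n | `[< exists z, R h z v >]]>>%VS.

Lemma mr_lin0 h : R h 0 0.
Proof.
have [v Rv] := mr_total mr h 0.
by have := mr_lin mr (-1) Rv Rv; rewrite !scaleN1r !addNr.
Qed.

Lemma rel_stabP h v : reflect (R h 0 v) (v \in rel_stab h).
Proof.
rewrite /rel_stab mem_span_enum; first exact: asboolP.
  by apply/asboolP/mr_lin0.
move=> a u u' /asboolP Ru /asboolP Ru'; apply/asboolP.
by have := mr_lin mr a Ru Ru'; rewrite scaler0 addr0.
Qed.

Lemma rel_QZP h v : reflect (exists z, R h z v) (v \in QZ (rel_css h)).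
Proof.
rewrite /rel_css mem_span_enum; first exact: asboolP.
  by apply/asboolP; exists 0; apply: mr_lin0.
move=> a u u' /asboolP[z Ru] /asboolP[z' Ru']; apply/asboolP.
by exists (a *: z + z'); apply: (mr_lin mr).
Qed.

Lemma dualv_rel_QX h : dualv (QX (rel_css h)) = rel_stab h.
Proof. exact: dualvK. Qed.

Lemma rel_is_css h : is_css (rel_css h).
Proof.
rewrite /is_css dualv_rel_QX; apply/subvP => v /rel_stabP Rv.
by apply/rel_QZP; exists 0.
Qed.

Lemma rel_encoder : exists E : 'I_3 -> 'M[F]_(k, n), forall h z, R h z (z *m E h).
Proof.
have /fin_all_exists[E HE] h : exists E : 'M[F]_(k, n), forall z, R h z (z *m E).
  have /fin_all_exists[v Hv] i := mr_total mr h (delta_mx 0 i).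
  exists (\matrix_i v i) => z; rewrite mulmx_sum_row {1}[z]row_sum_delta.
  elim/big_rec2: _ => [|i u u' _ Ru]; first exact: mr_lin0.
  by rewrite rowK; apply: (mr_lin mr).
by exists E.
Qed.

Section Encoder.
Hypothesis d_gt0 : (0 < d)%N.
Variable E : 'I_3 -> 'M[F]_(k, n).
Hypothesis HE : forall h z, R h z (z *m E h).

Lemma rel_subP h z v : R h z v <-> R h 0 (v - z *m E h).
Proof.
split=> [Rv|R0].
  by have := mr_lin mr (-1) (HE h z) Rv; rewrite !scaleN1r addNr addrC.
by have := mr_lin mr 1 R0 (HE h z); rewrite !scale1r add0r subrK.
Qed.

(** By linearity the zero word would encode [z], but its weight is below [d] unless [z = 0]. *)
Lemma rel_uniq h z v : R h z v -> R h 0 v -> z = 0.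
Proof.
move=> Rz R0; have := mr_lin mr (-1) R0 Rz; rewrite scaler0 add0r scaleN1r addNr => Rz0.
apply: contraTeq d_gt0 => zn0; rewrite -leqNgt (leq_trans (mr_dist mr Rz0 zn0)) //.
by rewrite leqn0 cards_eq0; apply/eqP/setP => i; rewrite !inE mxE eqxx.
Qed.

Lemma rel_is_encZ h : is_encZ (rel_css h) (E h).
Proof.
split=> [z|z|w].
- by apply/rel_QZP; exists z.
- by rewrite dualv_rel_QX => /rel_stabP; apply: rel_uniq.
- case/rel_QZP=> z Rw; exists z; rewrite dualv_rel_QX; apply/rel_stabP.
  exact: (proj1 (rel_subP h z w)).
Qed.

(** [QZ] is the direct sum of the encodings of 0 and the image of the injective map [E h]. *)
Lemma rel_css_dim h : css_dim (rel_css h) = k.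
Proof.
pose g := linfun (mulmxr (E h) : 'rV[F]_k -> 'rV[F]_n).
have gE z : g z = z *m E h by rewrite lfunE.
rewrite /css_dim dualv_rel_QX.
have -> : QZ (rel_css h) = (rel_stab h + limg g)%VS.
  apply/vspaceP => v; apply/rel_QZP/memv_addP => [[z Rv]|[u /rel_stabP Ru [v']]].
    exists (v - z *m E h); first exact/rel_stabP/(proj1 (rel_subP h z v)).
    by exists (z *m E h); rewrite ?subrK // -gE memv_img ?memvf.
  case/memv_imgP=> z _ -> ->; exists z; rewrite gE.
  by apply: (proj2 (rel_subP h z _)); rewrite addrK.
rewrite dimv_disjoint_sum ?addKn.
  rewrite limg_dim_eq ?dimvf /= /dim /= ?mul1n //.
  apply/eqP; rewrite capfv -subv0; apply/subvP => z; rewrite memv_ker gE => /eqP z0.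
  by rewrite memv0; apply/eqP/(@rel_uniq h z 0); [rewrite -z0 | apply: mr_lin0].
apply/eqP; rewrite -subv0; apply/subvP => v /memv_capP[/rel_stabP R0 /memv_imgP[z _ e]].
rewrite gE in e; rewrite memv0 e (_ : z = 0) ?mul0mx //.
by apply: (@rel_uniq h z v) => //; rewrite e.
Qed.

Lemma rel_logicalP h y : reflect
  ((forall s, R h 0 s -> dotv y s = 0) /\ (exists z v, R h z v /\ dotv y v != 0)
   \/ (exists z, R h z y) /\ ~ R h 0 y) (css_logical (rel_css h) y).
Proof.
rewrite /css_logical dualv_rel_QX; apply: (iffP orP) => -[].
- case/andP=> /mem_dualv Hy yZ; left; split; first by move=> s /rel_stabP/Hy.
  apply: contrapT => no; case/negP: yZ; apply/mem_dualv => v /rel_QZP[z Rv].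
  by apply/eqP; apply: contrapT => /negP yv; apply: no; exists z, v.
- case/andP=> /rel_QZP yZ /negP yS; right; split=> // R0.
  by apply: yS; apply/rel_stabP.
- case=> Hy [z [v [Rv yv]]]; left; apply/andP; split.
    by apply/mem_dualv => s /rel_stabP/Hy.
  by apply/negP => /mem_dualv H; case/eqP: yv; apply: H; apply/rel_QZP; exists z.
- case=> yZ yS; right; apply/andP; split; first exact/rel_QZP.
  by apply/negP => /rel_stabP.
Qed.

(** Z operators are bounded by [mr_dist]. If an X operator [y] had weight below [d], privacy would
    give an encoding of 0 agreeing with [v] on the support of [y], forcing [dotv y v = 0]. *)
Lemma rel_css_dist h : (0 < k)%N -> (d <= css_dist (rel_css h))%N.
Proof.
move=> k_gt0; rewrite leq_css_dist; apply/andP; split.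
(* The default value [n] of the minimum is at least [d], since a nonzero [z] exists and its encoding
   has weight between [d] and [n]. *)
- pose z : 'rV[F]_k := const_mx 1.
  have zn0 : z != 0.
    apply/eqP => /rowP/(_ (Ordinal k_gt0)); rewrite !mxE => /eqP; exact/negP/oner_neq0.
  by rewrite (leq_trans (mr_dist mr (HE h z) zn0)) // /wt -[X in (_ <= X)%N]card_ord max_card.
- apply/forallP => y; apply/implyP.
  move=> /rel_logicalP[[Hy [z [v [Rv yv]]]] | [[z Ry] yS]]; last first.
    apply: (mr_dist mr Ry); apply/eqP => z0; apply: yS; by rewrite -z0.
  rewrite leqNgt; apply/negP => lt_wt.
  have [v' Rv' Hv'] := mr_priv mr 0 lt_wt Rv.
  case/eqP: yv; rewrite -(Hy _ Rv'); apply: eq_bigr => i _.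
  have [->|yi] := eqVneq (y 0 i) 0; first by rewrite !mul0r.
  by rewrite Hv' // inE.
Qed.

Lemma rel_supports_CCZ : supports_CCZ rel_css E.
Proof.
have [b Hb] := mr_mult mr; exists b => z1 z2 z3 z1' z2' z3'.
rewrite /in_enc !dualv_rel_QX.
move=> /rel_stabP R1 /rel_stabP R2 /rel_stabP R3.
have {}R1 := proj2 (rel_subP _ _ _) R1; have {}R2 := proj2 (rel_subP _ _ _) R2.
have {}R3 := proj2 (rel_subP _ _ _) R3.
pose zz (h : 'I_3) := if h == 0 then z1 else if h == 1 then z2 else z3.
pose vv (h : 'I_3) := if h == 0 then z1' else if h == 1 then z2' else z3'.
apply: (Hb zz vv) => h; rewrite /zz /vv.
case: (eqVneq h 0) => [->//|h0]; case: (eqVneq h 1) => [->//|h1].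
suff -> : h = 2 by [].
by case: h h0 h1 => -[|[|[|//]]] ? // _ _; apply: val_inj.
Qed.

Lemma rel_supports_U : (forall h, R h = R 0) -> supports_U (rel_css 0) (E 0).
Proof.
move=> eqR; have [b Hb] := mr_mult mr; exists b => z z'.
rewrite /in_enc dualv_rel_QX => /rel_stabP R0; have {}R0 := proj2 (rel_subP _ _ _) R0.
transitivity (\sum_j z 0 j * z 0 j * z 0 j).
  by apply: eq_bigr => i _; rewrite !exprS expr0 mulr1 mulrA.
rewrite (Hb (fun=> z) (fun=> z')) => [|h]; last by rewrite eqR.
by apply: eq_bigr => i _; rewrite !exprS expr0 mulr1 !mulrA.
Qed.

(** Permuting positions preserves [dotv] and [wt], so it carries logical operators to logical
    operators of equal weight. *)
Lemma rel_css_dist_perm h (g : {perm 'I_n}) :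
  (forall z v, R h z v <-> R 0 z (col_perm g v)) ->
  css_dist (rel_css h) = css_dist (rel_css 0).
Proof.
move=> Hg; rewrite /css_dist.
have inj_g : injective (@col_perm F 1 n g).
  by move=> u v /(congr1 (col_perm g^-1%g)); rewrite -!col_permM mulVg !col_perm1.
have Hg' z v : R 0 z v <-> R h z (col_perm g^-1%g v).
  by rewrite Hg -col_permM mulgV col_perm1.
have dotg (u v : 'rV[F]_n) : dotv (col_perm g u) (col_perm g v) = dotv u v.
  rewrite /dotv [RHS](reindex_inj (@perm_inj _ g)).
  by apply: eq_bigr => i _; rewrite !mxE.
have wtg (y : 'rV[F]_n) : wt (col_perm g y) = wt y.
  rewrite /wt -(card_imset _ (@perm_inj _ g)); apply: eq_card => i.
  rewrite inE; apply/imsetP/idP => [[m]|yi].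
    by rewrite inE mxE => ym ->.
  by exists (g^-1%g i); rewrite ?permKV // inE mxE permKV.
have Rg0 z v : R 0 z (col_perm g v) <-> R h z v by split=> /Hg.
suff logg y : css_logical (rel_css h) y = css_logical (rel_css 0) (col_perm g y).
  suff eqd m : (m <= css_dist (rel_css h))%N = (m <= css_dist (rel_css 0%R))%N.
    by apply/eqP; rewrite eqn_leq -eqd leqnn eqd leqnn.
  rewrite !leq_css_dist; congr (_ && _); apply/forallP/forallP => H y.
    have := H (col_perm g^-1%g y).
    by rewrite logg -(wtg (col_perm _ _)) -col_permM mulgV col_perm1.
  by rewrite logg -wtg.
apply/rel_logicalP/rel_logicalP => -[[Hy [z [v [Rv yv]]]] | [[z Ry] yS]].
- left; split.
    move=> s R0; have := Hy (col_perm g^-1%g s); rewrite -Hg' => /(_ R0).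
    by rewrite -dotg -col_permM mulgV col_perm1.
  by exists z, (col_perm g v); rewrite Rg0 dotg.
- by right; split; [exists z; apply/Rg0 | rewrite Rg0].
- left; split; first by move=> s /Rg0/Hy; rewrite dotg.
  exists z, (col_perm g^-1%g v); rewrite -Hg'; split=> //.
  by rewrite -dotg -col_permM mulgV col_perm1.
- by right; split; [exists z; apply/Rg0 | rewrite -Rg0].
Qed.

End Encoder.
End Relation.

(** * Schemes in coordinates, through the embedding of logical words *)

Section SchemeToRelation.
Variables (F K : finFieldType) (iota : {rmorphism F -> K}) (I J : finType) (d : nat).
Variables (Enc : 'I_3 -> scheme F K I) (e : J -> K) (l : K -> F).
Hypothesis ms : mult_scheme iota d Enc.
Hypothesis l_lin : F_linear iota l.
Hypothesis l_orth : forall a b c, l (e a * e b * e c) = ((a == b) && (b == c))%:R.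

Definition rmfe (z : 'rV[F]_#|J|) : K := \sum_a iota (z 0 (enum_rank a)) * e a.

Definition scheme_rel (h : 'I_3) (z : 'rV[F]_#|J|) (v : 'rV[F]_#|I|) : Prop :=
  Enc h (rmfe z) (fun i => v 0 (enum_rank i)).

Lemma rmfe_lin a z z' : rmfe (a *: z + z') = iota a * rmfe z + rmfe z'.
Proof.
rewrite /rmfe mulr_sumr -big_split; apply: eq_bigr => i _ /=.
by rewrite !mxE rmorphD rmorphM mulrDl mulrA.
Qed.

Lemma rmfe_mult z1 z2 z3 :
  l (rmfe z1 * rmfe z2 * rmfe z3) = \sum_i z1 0 i * z2 0 i * z3 0 i.
Proof.
pose y (z : 'rV[F]_#|J|) a := z 0 (enum_rank a).
transitivity (\sum_a \sum_b \sum_c (y z1 a * y z2 b * y z3 c) *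
                ((a == b) && (b == c))%:R).
  rewrite /rmfe big_distrlr /= mulr_suml (F_linear_sum l_lin); apply: eq_bigr => a _.
  rewrite mulr_suml (F_linear_sum l_lin); apply: eq_bigr => b _.
  rewrite mulr_sumr (F_linear_sum l_lin); apply: eq_bigr => c _.
  rewrite -l_orth -(F_linearZ l_lin) !rmorphM /=; congr l.
  by rewrite -!/(y _ _); ring.
rewrite [RHS](reindex (@enum_rank J)) /=; last first.
  by exists enum_val => a _; rewrite ?enum_rankK ?enum_valK.
apply: eq_bigr => a _; rewrite (bigD1 a) //= [X in _ + X]big1 => [|b ba]; last first.
  by rewrite big1 // => c _; rewrite [a == b]eq_sym (negPf ba) mulr0.
rewrite addr0 (bigD1 a) //= [X in _ + X]big1 => [|c ca]; last first.
  by rewrite [a == c]eq_sym (negPf ca) andbF mulr0.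
by rewrite !eqxx mulr1 addr0.
Qed.

(** Multiplying by the embedding of the [i]-th unit vector twice and applying [l] recovers
    coordinate [i] of [z]. *)
Lemma rmfe_neq0 z : z != 0 -> rmfe z != 0.
Proof.
apply: contraNneq => z0; apply/eqP/rowP => i; rewrite mxE.
have := rmfe_mult z (delta_mx 0 i) (delta_mx 0 i).
rewrite z0 !mul0r (F_linear0 l_lin) (bigD1 i) //= !mxE !eqxx !mulr1 big1 ?addr0 // => k ki.
by rewrite !mxE (negPf ki) andbF !mulr0.
Qed.

Lemma wt_enum (v : 'rV[F]_#|I|) :
  #|[set i | v 0 (enum_rank i) != 0%R]| = wt v.
Proof.
rewrite /wt -(card_imset _ (@enum_rank_inj I)); apply: eq_card => i.
rewrite inE; apply/imsetP/idP => [[k]|vi]; first by rewrite inE => vk ->.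
by exists (enum_val i); rewrite ?inE enum_valK.
Qed.

Lemma scheme_mult_relation : mult_relation d scheme_rel.
Proof.
split.
- move=> h a z z' v v' Rv Rv'; rewrite /scheme_rel rmfe_lin.
  have := ms_lin ms a Rv Rv'; congr (Enc h _ _).
  by apply/funext => i; rewrite !mxE.
- move=> h z; have [v Ev] := ms_total ms h (rmfe z).
  exists (\row_i v (enum_val i)); move: Ev; congr (Enc h _ _).
  by apply/funext => i; rewrite !mxE enum_rankK.
- by move=> h z v Ev zn0; rewrite -wt_enum; apply: (ms_dist ms Ev); apply: rmfe_neq0.
- move=> h z v z' A ltA Ev.
  have ltA' : (#|[set i | enum_rank i \in A]| < d)%N.
    apply: leq_ltn_trans ltA; rewrite -(card_imset _ (@enum_rank_inj I)).
    by apply/subset_leq_card/fintype.subsetP => _ /imsetP[i + ->]; rewrite inE.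
  have [v' Ev' Hv'] := ms_priv ms (rmfe z') ltA' Ev.
  exists (\row_i v' (enum_val i)).
    move: Ev'; congr (Enc h _ _).
    by apply/funext => i; rewrite !mxE enum_rankK.
  by move=> i iA; rewrite mxE Hv' ?inE enum_valK.
- have [b Hb] := ms_mult ms l_lin; exists (\row_i b (enum_val i)) => z v Hv.
  rewrite -rmfe_mult (Hb (fun h => rmfe (z h)) (fun h i => v h 0 (enum_rank i))) //.
  rewrite [RHS](reindex (@enum_rank I)) /=; last first.
    by exists enum_val => a _; rewrite ?enum_rankK ?enum_valK.
  by apply: eq_bigr => i _; rewrite mxE enum_rankK.
Qed.

Lemma scheme_rel_perm h (g : I -> I) : injective g ->
  (forall x v, Enc h x v <-> Enc 0 x (v \o g)) ->
  exists p : {perm 'I_#|I|}, forall z v,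
    scheme_rel h z v <-> scheme_rel 0 z (col_perm p v).
Proof.
move=> g_inj Hg; have p_inj : injective (fun i : 'I_#|I| => enum_rank (g (enum_val i))).
  by move=> i k /enum_rank_inj/g_inj/enum_val_inj.
exists (perm p_inj) => z v; rewrite /scheme_rel Hg.
suff -> : (fun i => v 0 (enum_rank i)) \o g =
          (fun i => col_perm (perm p_inj) v 0 (enum_rank i)) by [].
by apply/funext => i; rewrite mxE permE enum_rankK.
Qed.
End SchemeToRelation.

Lemma code_level_css (F : finFieldType) sym m0 t : code_level F sym m0 t ->
  exists (n k : nat) (Q : 'I_3 -> css_pair F n) (E : 'I_3 -> 'M[F]_(k, n)),
  [/\ n = (m0 * 6 ^ t * tow t)%N, (k * 3 ^ t = tow t)%N,
      forall h, is_css (Q h) /\ css_dim (Q h) = k,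
      forall h, css_dist (Q h) = css_dist (Q 0) /\ is_encZ (Q h) (E h) &
      [/\ (tow t <= css_dist (Q 0%R))%N, supports_CCZ Q E &
          sym -> (forall h, Q h = Q 0) /\ supports_U (Q 0) (E 0)]].
Proof.
case=> K [iota [I [J [Enc [[_ ms] cardI [cardJ [e [l [l_lin l_orth]]]] iso eqs]]]]].
have mr := scheme_mult_relation ms l_lin l_orth.
have [E HE] := rel_encoder mr.
have J_gt0 : (0 < #|J|)%N by have := tow_gt0 t; rewrite -cardJ muln_gt0 => /andP[].
have d_gt0 := tow_gt0 t.
exists #|I|, #|J|, (rel_css (scheme_rel iota Enc e)), E; split=> //.
- move=> h; split; first exact: rel_is_css mr h.
  exact: (rel_css_dim mr d_gt0 HE).
- move=> h; split; last exact: (rel_is_encZ mr d_gt0 HE).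
  have [g g_inj Hg] := iso h.
  have [p Hp] := scheme_rel_perm iota e g_inj Hg.
  exact (rel_css_dist_perm mr Hp).
- split; first exact: (rel_css_dist mr HE).
    exact: (rel_supports_CCZ mr HE).
  move=> /eqs eqE; have eqR h : scheme_rel iota Enc e h = scheme_rel iota Enc e 0.
    by rewrite /scheme_rel eqE.
  split; last exact: (rel_supports_U mr HE).
  by move=> h; rewrite /rel_css /rel_stab eqR.
Qed.

(** * Iterated logarithm and rates *)

Section Rate.
Variable R : realType.

Lemma tow_exp t : (2 ^ tow t <= tow t.+1)%N.
Proof.
rewrite /= -{1}(prednK (tow_gt0 t)) expnS; have := tow_gt0 t.
by move: (tow t) (2 ^ _)%N => a b; nia.
Qed.

(** By [tow_exp], one application of [log2] descends at most one level of [tow]. *)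
Lemma logstar_fuel_ge t f (x : R) :
  (tow t)%:R <= x -> (t <= f)%N -> (t <= logstar_fuel f x)%N.
Proof.
elim: t f x => // t IH [//|f] x lex; rewrite ltnS => ltf.
have le2 : 2 ^+ tow t <= x by apply: le_trans lex; rewrite -natrX ler_nat tow_exp.
have x_gt1 : 1 < x.
  by apply: lt_le_trans le2; rewrite exprn_egt1 ?ltr1n // -lt0n tow_gt0.
rewrite [logstar_fuel _ _]/= leNgt x_gt1 /= ltnS; apply: IH => //.
have ln2_gt0 : 0 < ln (2 : R) by rewrite ln_gt0 ?ltr1n.
rewrite /log2 ler_pdivlMr // mulr_natl -lnXn //.
by rewrite ler_ln ?posrE // ?exprn_gt0 // (lt_trans ltr01).
Qed.

Lemma leq_level m0 t : (0 < m0)%N -> (t <= m0 * 6 ^ t * tow t)%N.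
Proof.
move=> m0_gt0; rewrite (leq_trans (ltnW (ltn_expl t (isT : (1 < 6)%N)))) //.
by rewrite mulnAC leq_pmull // muln_gt0 m0_gt0 tow_gt0.
Qed.

(** The right side is [n / (m0 * 18 ^ t)], and [18 ^ t] is at most [2 ^ (5 * t)] with [t] at most
    [logstar R n]; hence the constants [1 / m0] and 5. *)
Lemma rate_bound_level m0 t : (0 < m0)%N ->
  rate_bound (m0%:R^-1 : R) 5 (m0 * 6 ^ t * tow t) <= (tow t)%:R / (3 ^ t)%:R.
Proof.
move=> m0_gt0; set n := (_ * tow t)%N.
have le_tn : (t <= n)%N := leq_level t m0_gt0.
have le_t : (t <= logstar R n)%N.
  apply: logstar_fuel_ge => //; rewrite ler_nat leq_pmull // muln_gt0 m0_gt0.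
  by rewrite expn_gt0.
have le_pow : (6 ^ t * 3 ^ t)%:R <= (2 : R) `^ (5 * (logstar R n)%:R).
  rewrite -natrM powR_mulrn // -natrX ler_nat -expnMn expnM.
  rewrite (@leq_trans ((2 ^ 5) ^ t)) ?leq_pexp2l //.
  by case: (t) => // t'; rewrite leq_exp2r.
have m0n : (m0%:R : R) != 0 by rewrite pnatr_eq0 -lt0n.
have p6 : (0 : R) < (6 ^ t)%:R by rewrite ltr0n expn_gt0.
have p3 : (0 : R) < (3 ^ t)%:R by rewrite ltr0n expn_gt0.
have -> : (tow t)%:R / (3 ^ t)%:R = m0%:R^-1 * n%:R / (6 ^ t * 3 ^ t)%:R :> R.
  by rewrite /n !natrM; field; rewrite m0n !gt_eqF.
rewrite /rate_bound ler_wpM2l ?mulr_ge0 ?invr_ge0 ?ler0n //.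
rewrite lef_pV2 ?posrE ?powR_gt0 ?ltr0n // muln_gt0 !expn_gt0 //.
Qed.

Lemma good_family_of_levels (F : finFieldType) sym m0 : (0 < m0)%N ->
  (forall t, code_level F sym m0 t) ->
  exists (n k d : nat -> nat) (Q : forall t, 'I_3 -> css_pair F (n t)),
    [/\ good_CCZ_family (m0%:R^-1 : R) 5 k d Q,
        sym -> forall t h, Q t h = Q t 0 &
        sym -> forall t, exists E : 'M[F]_(k t, n t),
          is_encZ (Q t 0) E /\ supports_U (Q t 0) E].
Proof.
move=> m0_gt0 lev; pose T := {n : nat & nat * ('I_3 -> css_pair F n)}%type.
pose good t (u : T) := exists E : 'I_3 -> 'M[F]_((projT2 u).1, projT1 u),
  let Q := (projT2 u).2 in
  [/\ projT1 u = (m0 * 6 ^ t * tow t)%N, ((projT2 u).1 * 3 ^ t = tow t)%N,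
      forall h, is_css (Q h) /\ css_dim (Q h) = (projT2 u).1,
      forall h, css_dist (Q h) = css_dist (Q 0) /\ is_encZ (Q h) (E h) &
      [/\ (tow t <= css_dist (Q 0%R))%N, supports_CCZ Q E &
          sym -> (forall h, Q h = Q 0) /\ supports_U (Q 0) (E 0)]].
have /choice[u Hu] : forall t, exists u, good t u.
  move=> t; have [n [k [Q [E HQ]]]] := code_level_css (lev t).
  by exists (existT _ n (k, Q)), E.
exists (fun t => projT1 (u t)), (fun t => (projT2 (u t)).1).
exists (fun t => css_dist ((projT2 (u t)).2 0)), (fun t => (projT2 (u t)).2).
have nE t : projT1 (u t) = (m0 * 6 ^ t * tow t)%N by have [E []] := Hu t.
have kE t : ((projT2 (u t)).1)%:R = (tow t)%:R / (3 ^ t)%:R :> R.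
  have [E [_ <- _ _ _]] := Hu t.
  by rewrite natrM mulfK // pnatr_eq0 -lt0n expn_gt0.
split=> [|s t|s t]; last 2 first.
- by have [E [_ _ _ _ [_ _ /(_ s)[]]]] := Hu t.
- have [E [_ _ _ He [_ _ /(_ s)[_ U]]]] := Hu t.
  by exists (E 0); split=> //; have [] := He 0.
do !split.
- by move=> t h; have [E [_ _ /(_ h)[]]] := Hu t.
- by move=> t h; have [E [_ _ /(_ h)[]]] := Hu t.
- by move=> t h; have [E [_ _ _ /(_ h)[]]] := Hu t.
- move=> t; have [E [_ _ _ He [_ CCZ _]]] := Hu t; exists E; split=> // h.
  by have [] := He h.
- move=> N; exists N => t leNt; rewrite nE.
  exact: leq_trans leNt (leq_level t m0_gt0).
- by move=> t; rewrite kE nE; apply: rate_bound_level.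
- move=> t; have [E [_ _ _ _ [led _ _]]] := Hu t.
  have := rate_bound_level t m0_gt0; rewrite -nE => /le_trans; apply.
  (* The distance is at least [tow t], which dominates the dimension [tow t / 3 ^ t]. *)
  apply: (@le_trans _ _ (tow t)%:R); last by rewrite ler_nat.
  by rewrite ler_pdivrMr ?ltr0n ?expn_gt0 // ler_peMr ?ler0n // ler1n expn_gt0.
Qed.
End Rate.

(** * The two families, for arbitrary fields and for fields of at least 5 elements *)

Theorem theoremB1 (R : realType) (F : finFieldType) :
  (exists (c C : R) (n k d : nat -> nat) (Q : forall t, 'I_3 -> css_pair F (n t)),
     0 < c /\ 0 < C /\ good_CCZ_family c C k d Q)
  /\
  ((5 <= #|F|)%N ->
   exists (c C : R) (n k d : nat -> nat) (Q : forall t, 'I_3 -> css_pair F (n t)),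
     [/\ 0 < c, 0 < C, good_CCZ_family c C k d Q,
         forall t (h : 'I_3), Q t h = Q t 0 &
         forall t, exists E : 'M[F]_(k t, n t),
           is_encZ (Q t 0) E /\ supports_U (Q t 0) E]).
Proof.
split.
  have lev t : code_level F false 125 t.
    by elim: t => [|t IH]; [exact: code_level0 | exact: code_levelS].
  have [n [k [d [Q [good _ _]]]]] := good_family_of_levels R (isT : (0 < 125)%N) lev.
  by exists 125%:R^-1, 5, n, k, d, Q; rewrite invr_gt0 !ltr0n.
move=> F5; have lev t : code_level F true 4 t.
  by elim: t => [|t IH]; [exact: sym_code_level0 | exact: code_levelS].
have [n [k [d [Q [good /(_ isT) eqQ /(_ isT) U]]]]] :=
  good_family_of_levels R (isT : (0 < 4)%N) lev.
by exists 4%:R^-1, 5, n, k, d, Q; split; rewrite ?invr_gt0 ?ltr0n.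
Qed.
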